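(* Let $w\in\mathbb{R}^N\setminus\{0\}$, $\beta\in(0,1]$ and $K=C(w,\beta)$. Let $f\colon K\to\mathbb{R}^N$ be a continuous mapping. Suppose there is $x'>_K0$ in the set $\mathcal{S}_f=\{x\geqslant_K0\mid f(x)\leqslant_K x\}$ and that $f$ is $K$-monotonic with respect to the cone $K=C(w,\beta)$, i.e. $x\leqslant_K y$ implies $f(x)\leqslant_K f(y)$. Then there exists a fixed point of $f$.
   Context: $C(w,\beta):=\{v\in\mathbb{R}^N:\langle v,w\rangle\ge\beta\|v\|\|w\|\}$ with the Euclidean norm. For the cone $K$ write $x\leqslant_K y$ (equivalently $y\geqslant_K x$) if $y-x\in K$, and $x<_K y$ (equivalently $y>_K x$) if $y-x\in K\setminus\{0\}$.
   Formalization: The mapping f is additionally assumed to send K into K (instead of merely into R^N); without this the claim fails, e.g. for N=1, w=1, β=1, K=[0,∞), f(x)=x−1, x'=1. *)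

(* Defs.v *)
(* MathComp / MathComp-Analysis development *)
From mathcomp Require Import all_boot all_order all_algebra.
From mathcomp Require Import all_classical all_reals all_analysis.
Import Order.TTheory GRing.Theory Num.Theory.
Import numFieldNormedType.Exports.

Set Implicit Arguments.
Unset Strict Implicit.
Unset Printing Implicit Defensive.

Local Open Scope classical_set_scope.
Local Open Scope ring_scope.

Definition dotv (R : realType) (N : nat) (u v : 'rV[R]_N) : R :=
  \sum_i u 0 i * v 0 i.

(* The library norm `|v| on 'rV[R]_N is the sup norm, hence this definition;
   both norms induce the topology that 'rV[R]_N carries. *)
Definition enorm (R : realType) (N : nat) (v : 'rV[R]_N) : R :=
  Num.sqrt (dotv v v).

Definition cone (R : realType) (N : nat) (w : 'rV[R]_N) (beta : R)
    : set 'rV[R]_N :=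
  [set v | beta * enorm v * enorm w <= dotv v w].

Definition leK (V : zmodType) (K : set V) (x y : V) : Prop := K (y - x).

Definition ltK (V : zmodType) (K : set V) (x y : V) : Prop :=
  (K `\ 0) (y - x).

Definition Sset (V : zmodType) (K : set V) (f : V -> V) : set V :=
  [set x | leK K 0 x /\ leK K (f x) x].

(* A map defined on K is encoded by a total function, of which only the values
   on K matter; monotonicity is accordingly required between points of K. *)
Definition Kmonotonic (V : zmodType) (K : set V) (f : V -> V) : Prop :=
  forall x y, K x -> K y -> leK K x y -> leK K (f x) (f y).

(* Main.v *)
Require Import Defs.
From mathcomp Require Import all_boot all_order all_algebra.
From mathcomp Require Import all_classical all_reals all_analysis.
Import Order.TTheory GRing.Theory Num.Theory.
Import numFieldNormedType.Exports.
Local Open Scope classical_set_scope.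
Local Open Scope ring_scope.

(** On the cone K the linear functional v |-> <v, w> dominates a multiple of
    the norm: beta |w| |v| <= <v, w> for v in K, where beta |w| > 0
    ([norm_le_dotv]). Hence a K-decreasing
    sequence u in K converges: the numbers <u_n, w> decrease and are
    nonnegative, so they converge, and beta |w| |u_{n+1} - u_n| is at most
    their decrement, so u has finite length and is Cauchy
    ([cvg_bounded_variation]).

    Apply this to the iterates u_n = f^n(x'). They remain in K, and they
    decrease because f(x') <= x' and f is monotonic. Their limit lies in K, a
    closed set ([closed_cone]), and it is fixed by continuity of f on K. *)

Lemma dotvBl (R : realType) (N : nat) (u v w : 'rV[R]_N) :
  dotv (u - v) w = dotv u w - dotv v w.
Proof.
rewrite /dotv -sumrB; apply: eq_bigr => i _.
by rewrite !mxE mulrBl.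
Qed.

Lemma dotvv_ge0 (R : realType) (N : nat) (v : 'rV[R]_N) : 0 <= dotv v v.
Proof. by apply: sumr_ge0 => i _; rewrite -expr2 sqr_ge0. Qed.

Lemma enorm_gt0 (R : realType) (N : nat) (v : 'rV[R]_N) :
  v != 0 -> 0 < enorm v.
Proof.
move=> v0; rewrite sqrtr_gt0 lt_neqAle dotvv_ge0 andbT eq_sym.
apply: contra v0 => /eqP /psumr_eq0P v0.
apply/eqP/rowP => i; rewrite mxE; apply/eqP.
by rewrite -sqrf_eq0 expr2 v0// => j _; rewrite -expr2 sqr_ge0.
Qed.

(** The norm [`|v|] on row vectors is the sup norm, and a single squared
    coordinate is one of the nonnegative terms of [dotv v v]. *)
Lemma mx_norm_le_enorm (R : realType) (N : nat) (v : 'rV[R]_N) :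
  `|v| <= enorm v.
Proof.
rewrite [leLHS]/Num.Def.normr /= mx_normrE; apply/bigmax_leP.
split=> [|[i j] _ /=].
  exact: sqrtr_ge0.
rewrite (ord1 i) -sqrtr_sqr ler_wsqrtr// /dotv (bigD1 j)//= expr2 lerDl.
by apply: sumr_ge0 => k _; rewrite -expr2 sqr_ge0.
Qed.

(** The sup norm is below the Euclidean norm of the cone inequality, so on the
    cone a linear functional controls the norm that defines convergence. *)
Lemma norm_le_dotv (R : realType) (N : nat) (w : 'rV[R]_N) (beta : R)
    (v : 'rV[R]_N) :
  0 <= beta -> cone w beta v -> beta * enorm w * `|v| <= dotv v w.
Proof.
move=> beta0; apply: le_trans; rewrite mulrAC.
rewrite ler_wpM2r ?sqrtr_ge0// ler_wpM2l//; exact: mx_norm_le_enorm.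
Qed.

Lemma continuous_dotv (R : realType) (N : nat) (T : topologicalType)
    (g h : T -> 'rV[R]_N) :
  continuous g -> continuous h -> continuous (fun t => dotv (g t) (h t)).
Proof.
move=> cg ch t.
have co (k : T -> 'rV[R]_N) i :
    continuous k -> k s 0 i @[s --> t] --> k t 0 i.
  move=> ck; apply: (cvg_comp k (fun M : 'rV[R]_N => M 0 i) (ck t)).
  exact: coord_continuous.
apply: (@cvg_big R _ +%R 0 xpredT add_continuous) => i _.
by apply: cvgM; apply: co.
Qed.

Lemma closed_cone (R : realType) (N : nat) (w : 'rV[R]_N) (beta : R) :
  closed (cone w beta).
Proof.
pose g (v : 'rV[R]_N) := dotv v w - beta * enorm v * enorm w.
have -> : cone w beta = g @^-1` [set r | 0 <= r].
  by apply/seteqP; split=> v; rewrite /g /cone /= subr_ge0.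
suff cg : continuous g.
  by apply: preimage_closed (@closed_ge R 0) => v _; exact: cg.
(* Composing with a map k from an abstract space keeps the topology of row
   vectors folded when the limit lemmas are unified. *)
suff cgk (T : topologicalType) (k : T -> 'rV[R]_N) :
    continuous k -> continuous (g \o k).
  by apply: (cgk _ id) => v; exact: cvg_id.
move=> ck t; apply: cvgB.
  exact: (continuous_dotv R N T k (fun=> w) ck (@cst_continuous _ _ w) t).
apply: cvgM; last exact: cvg_cst.
apply: cvgM; first exact: cvg_cst.
apply: (cvg_comp (fun s => dotv (k s) (k s)) Num.sqrt).
  exact: (continuous_dotv R N T k k ck ck t).
exact: sqrt_continuous.
Qed.

(** Telescoping bounds [`|u m - u n|] by [`|a m - a n|], and [a], nonincreasing
    and bounded below, is Cauchy. *)
Lemma cvg_bounded_variation (R : realType) (N : nat) (u : nat -> 'rV[R]_N)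
    (a : nat -> R) :
  (forall n, 0 <= a n) -> (forall n, `|u n.+1 - u n| <= a n - a n.+1) ->
  cvgn u.
Proof.
move=> a0 du.
have tele n m : (n <= m)%N -> `|u m - u n| <= a n - a m.
  move=> /subnK <-; elim: (m - n)%N => [|k IH]; first by rewrite !subrr normr0.
  have := lerD (du (k + n)%N) IH; rewrite [leRHS]addrC subrKA; apply: le_trans.
  by rewrite addSn -[X in `|X|](subrKA (u (k + n)%N)) ler_normD.
have absle n m : `|u n - u m| <= `|a n - a m|.
  have [nm|/ltnW mn] := leqP n m.
    by rewrite distrC (le_trans (tele _ _ nm))// ler_norm.
  by rewrite (le_trans (tele _ _ mn))// distrC ler_norm.
have ca : cvgn a.
  apply: nonincreasing_is_cvgn; last by exists 0 => _ [n _ <-].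
  apply/nonincreasing_seqP => n.
  by rewrite -subr_ge0 (le_trans _ (du n)).
apply/cauchy_cvgP/cauchy_ballP => e e0.
move/cvg_cauchy/cauchy_ballP : ca => /(_ _ e0).
rewrite !near_map2; apply: filterS => -[n m] /=.
rewrite -!ball_normE /=; exact: le_lt_trans.
Qed.

(* The hypothesis hfK says that f maps K into K. Without it, the statement
   fails for N = 1, w = 1, beta = 1 (K the nonnegative half-line) and
   f x = x - 1. *)
Theorem theorem7 (R : realType) (N : nat) (w : 'rV[R]_N) (beta : R)
    (f : 'rV[R]_N -> 'rV[R]_N)
    (hw : w != 0) (hbeta0 : 0 < beta) (hbeta1 : beta <= 1)
    (hfK : forall x, cone w beta x -> cone w beta (f x))
    (hcont : {within cone w beta, continuous f})
    (hS : exists2 x', ltK (cone w beta) 0 x' & Sset (cone w beta) f x')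
    (hmon : Kmonotonic (cone w beta) f) :
  exists2 x, cone w beta x & f x = x.
Proof.
set K := cone w beta in hfK hcont hS hmon *.
have [x' [+ _] [_ fx']] := hS; rewrite subr0 => Kx'.
pose u n := iter n f x'.
have Ku n : K (u n) by elim: n => [|n IH] //; exact: hfK.
have udec n : K (u n - u n.+1) by
  elim: n => [|n IH] //; exact: hmon (Ku n.+1) (Ku n) IH.
have c0 : 0 < beta * enorm w by rewrite mulr_gt0// enorm_gt0.
have cu : cvgn u.
  apply: (cvg_bounded_variation _ _ u
    (fun n => (beta * enorm w)^-1 * dotv (u n) w)) => n.
    rewrite mulr_ge0 ?invr_ge0 ?(ltW c0)//.
    apply: le_trans (norm_le_dotv _ _ _ _ _ (ltW hbeta0) (Ku n)).
    by rewrite mulr_ge0// ltW.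
  rewrite -mulrBr -dotvBl distrC ler_pdivlMl//.
  exact: norm_le_dotv (ltW hbeta0) (udec n).
have Kl : K (limn u).
  by apply: (closed_cvg K (closed_cone R N w beta) _ _ cu); apply: nearW.
exists (limn u) => //.
(* Continuity of f relative to K applies because u tends to its limit inside
   K, that is, along the trace on K of the neighbourhoods of the limit. *)
have fu : f (u n) @[n --> \oo] --> f (limn u).
  apply: (cvg_comp u f _ ((subspace_continuousP _ _).1 hcont _ Kl)).
  by move=> P /cu; apply: (@filterS _ \oo) => n; apply; exact: Ku.
apply: (cvg_unique (norm_hausdorff (V := 'rV[R]_N)) fu).
by move: cu; rewrite -cvg_shiftS.
Qed.
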